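(* Let $G$ be a graph with $n$ vertices and $m$ edges. Then $$EE(G)\geq e^{\frac{2m}{n}}+(n-1)-\frac{2m}{n}.$$ Equality holds if and only if $G$ is isomorphic to $\overline{K_n}$.
   Context: Graphs are finite, simple and undirected, with at least one vertex. For a graph $G$ with vertex set $\{1,\dots,n\}$, the adjacency matrix $A(G)$ is the symmetric $n\times n$ matrix with entry $1$ in position $(i,j)$ if $ij$ is an edge and $0$ otherwise; its eigenvalues (with multiplicity) are $\lambda_1\geq\dots\geq\lambda_n$. The Estrada index of $G$ is $EE(G)=\sum_{i=1}^n e^{\lambda_i}$. $\overline{K_n}$ denotes the edgeless graph on $n$ vertices (the complement of the complete graph $K_n$). *)

(* Defs.v *)
From mathcomp Require Import all_boot all_order all_algebra.
From mathcomp Require Import all_classical all_reals all_analysis.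

Set Implicit Arguments.
Unset Strict Implicit.
Unset Printing Implicit Defensive.

Import Order.TTheory GRing.Theory Num.Theory.

Local Open Scope ring_scope.

(* The vertex set {1, ..., n} is rendered as 'I_n = {0, ..., n - 1}. *)
Record sgraph (n : nat) := SGraph {
  adj : rel 'I_n;
  adj_sym : symmetric adj;
  adj_irr : irreflexive adj
}.

(* Each edge ij is the two-element set {i, j}, so it is counted once. *)
Definition edges (n : nat) (G : sgraph n) : {set {set 'I_n}} :=
  [set [set p.1; p.2] | p : 'I_n * 'I_n & adj G p.1 p.2].

Definition graph_iso (n k : nat) (G : sgraph n) (H : sgraph k) : Prop :=
  exists2 f : 'I_n -> 'I_k,
    bijective f & forall i j, adj H (f i) (f j) = adj G i j.

Lemma edgeless_sym (n : nat) : symmetric (fun _ _ : 'I_n => false).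
Proof. by []. Qed.

Lemma edgeless_irr (n : nat) : irreflexive (fun _ _ : 'I_n => false).
Proof. by []. Qed.

Definition edgeless (n : nat) : sgraph n :=
  SGraph (@edgeless_sym n) (@edgeless_irr n).

Definition adjmx (R : realType) (n : nat) (G : sgraph n) : 'M[R]_n :=
  \matrix_(i, j) (adj G i j)%:R.

(* The eigenvalues lambda_1 >= ... >= lambda_n, repeated according to their
   multiplicity: the nonincreasing list of roots of the characteristic
   polynomial.  There is at most one such list, and there is one exactly when
   the characteristic polynomial splits over R, as it does for a symmetric
   matrix; the default value [::] is returned otherwise. *)
Definition spectrum (R : realType) (n : nat) (A : 'M[R]_n) : seq R :=
  xget [::] [set s : seq R | sorted >=%R s /\
                             char_poly A = \prod_(x <- s) ('X - x%:P)]%classic.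

Definition estrada_index (R : realType) (n : nat) (G : sgraph n) : R :=
  \sum_(x <- spectrum (adjmx R G)) expR x.

(* Main.v *)
(** Bounding e^x >= 1 + x at every eigenvalue but the largest one l, and using
    that the trace vanishes, EE(G) >= e^l - l + (n - 1).  The Rayleigh quotient
    at the all-ones vector gives l >= 2m/n >= 0, and e^x - x is nondecreasing
    on [0, +oo).  In the equality case all eigenvalues other than l vanish,
    hence so does l by the trace, and 0 <= 2m/n <= l forces m = 0. *)

Require Import Defs.
From mathcomp Require Import all_boot all_order all_algebra.
From mathcomp Require Import all_classical all_reals all_analysis.
From mathcomp Require Import complex lra.

Set Implicit Arguments.
Unset Strict Implicit.
Unset Printing Implicit Defensive.

Import Order.TTheory GRing.Theory Num.Theory.

Local Open Scope ring_scope.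

(** Over the polynomial ring, P (X - A) = (X - B) P; taking determinants, [\det P] is a nonzero
    constant and cancels. *)
Lemma char_poly_conj (F : fieldType) (n : nat) (P A B : 'M[F]_n) :
  P \in unitmx -> P *m A = B *m P -> char_poly A = char_poly B.
Proof.
move=> P_unit PA_BP.
have PXA : map_mx polyC P *m char_poly_mx A = char_poly_mx B *m map_mx polyC P.
  by rewrite /char_poly_mx mulmxBr mulmxBl -!map_mxM PA_BP scalar_mxC.
have detP_neq0 : \det (map_mx polyC P) != 0.
  by rewrite det_map_mx polyC_eq0 -unitfE -unitmxE.
apply: (mulfI detP_neq0).
by rewrite /char_poly -det_mulmx PXA det_mulmx mulrC.
Qed.

(** In the coordinates w = v P^* the form is the sum of the d_i |w_i|^2, and w has the same norm as
    v because P is unitary. *)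
Lemma rayleigh_le (C : numClosedFieldType) (n : nat) (A P : 'M[C]_n)
    (d v : 'rV[C]_n) (t : C) :
  P \is unitarymx -> A = invmx P *m diag_mx d *m P -> (forall i, d 0 i <= t) ->
  (v *m A *m map_mx Num.conj v^T) 0 0 <= t * (v *m map_mx Num.conj v^T) 0 0.
Proof.
move=> P_unitary -> d_le; rewrite invmx_unitary//.
set w := v *m map_mx Num.conj P^T.
have w_adj : map_mx Num.conj w^T = P *m map_mx Num.conj v^T.
  by rewrite /w trmx_mul map_mxM/= trmxCK.
have -> : v *m (map_mx Num.conj P^T *m diag_mx d *m P) *m map_mx Num.conj v^T =
          w *m diag_mx d *m map_mx Num.conj w^T.
  by rewrite w_adj !mulmxA.
have -> : v *m map_mx Num.conj v^T = w *m map_mx Num.conj w^T.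
  by rewrite w_adj mulmxA /w mulmxKtV.
rewrite mul_mx_diag !mxE mulr_sumr; apply: ler_sum => i _.
by rewrite !mxE mulrAC -normCK mulrC ler_wpM2r ?exprn_ge0.
Qed.

(** Over R[i] the matrix becomes Hermitian, hence unitarily diagonalisable with real diagonal; both
    conclusions then descend to R along the embedding [f]. *)
Lemma symmetric_spectral (R : rcfType) (n : nat) (A : 'M[R]_n) :
  A^T = A ->
  exists2 d : 'I_n -> R, char_poly A = \prod_i ('X - (d i)%:P) &
    forall (v : 'rV[R]_n) (t : R), (forall i, d i <= t) ->
      (v *m A *m v^T) 0 0 <= t * (v *m v^T) 0 0.
Proof.
move=> A_sym; pose f := real_complex R; pose B := map_mx f A.
have real_conj k l (M : 'M[R]_(k, l)) : map_mx Num.conj (map_mx f M) = map_mx f M.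
  apply/matrixP => i j; rewrite !mxE.
  by apply/CrealP/complex_realP; exists (M i j).
have B_herm : B \is hermsymmx.
  by apply/is_hermitianmxP; rewrite expr0 scale1r -map_trmx real_conj map_trmx A_sym.
have /hermitian_normalmx/orthomx_spectralP B_eq := B_herm.
have /mxOverP d_real := hermitian_spectral_diag_real B_herm.
set P := spectralmx B in B_eq; set D := spectral_diag B in B_eq d_real.
pose d i := complex.Re (D 0 i).
have dE i : f (d i) = D 0 i by rewrite /f /d RRe_real.
exists d => [|v t d_le].
  apply: (@map_poly_inj _ _ f); rewrite map_char_poly map_prod_XsubC.
  rewrite (@char_poly_conj _ _ P B (diag_mx D)) ?spectral_unit//; last first.
    by rewrite [in LHS]B_eq !mulmxA mulmxV ?spectral_unit// mul1mx.
  rewrite char_poly_trig ?diag_mx_is_trig//; apply: eq_bigr => i _.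
  by rewrite mxE eqxx -dE.
have := @rayleigh_le _ _ B P D (map_mx f v) (f t) (spectral_unitarymx B) B_eq.
rewrite -map_trmx real_conj map_trmx -!map_mxM !mxE -rmorphM lecR; apply => i.
by rewrite -dE lecR.
Qed.

Lemma spectrumP (R : realType) (n : nat) (A : 'M[R]_n) :
  A^T = A ->
  [/\ sorted >=%R (spectrum A),
      char_poly A = \prod_(x <- spectrum A) ('X - x%:P) &
      forall (v : 'rV[R]_n) (t : R), (forall x, x \in spectrum A -> x <= t) ->
        (v *m A *m v^T) 0 0 <= t * (v *m v^T) 0 0].
Proof.
move=> A_sym; have [d charA rayA] := symmetric_spectral A_sym.
(* Sorting the diagonal values gives a witness, so [spectrum A] is not the default value of
   [xget]. *)
have /(xgetPex [::])[s_sorted s_char] : exists s : seq R,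
    [set s | sorted >=%R s /\
             char_poly A = \prod_(x <- s) ('X - x%:P)]%classic s.
  exists (sort >=%R [seq d i | i <- enum 'I_n]); split.
    by apply: sort_sorted => x y; exact: le_total.
  by rewrite charA (perm_big _ (permEl (perm_sort _ _))) big_map big_enum.
rewrite -/(spectrum A) in s_sorted s_char.
split=> // v t s_le; apply: rayA => i; apply: s_le.
(* Each [d i] is a root of the characteristic polynomial, hence an entry of the spectrum, and so is
   bounded by [t]. *)
rewrite -root_prod_XsubC -s_char charA.
by rewrite (bigD1 i)//= rootM root_XsubC eqxx.
Qed.

Lemma size_spectrum (R : realType) (n : nat) (A : 'M[R]_n) :
  A^T = A -> size (spectrum A) = n.
Proof.
move=> /spectrumP[_ charA _]; apply/eqP; rewrite -eqSS.
by rewrite -(size_prod_XsubC _ id) -charA size_char_poly.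
Qed.

Lemma sum_spectrum (R : realType) (n : nat) (A : 'M[R]_n) :
  A^T = A -> \sum_(x <- spectrum A) x = \tr A.
Proof.
move=> A_sym; have [_ charA _] := spectrumP A_sym.
have sz := size_spectrum A_sym; have [n0|n_gt0] := posnP n.
  rewrite (size0nil (etrans sz n0)) big_nil /mxtrace big1// => i _.
  by have := ltn_ord i; rewrite [X in (_ < X)%N]n0.
(* Both sides are, up to sign, the coefficient of X^(n-1) in the characteristic polynomial; this
   needs n > 0. *)
apply: oppr_inj; rewrite -char_poly_trace// charA.
by rewrite -coefPn_prod_XsubC sz -?lt0n.
Qed.

(** The ordered adjacent pairs are grouped by their underlying edge {a, b}: each fibre is {(a, b),
    (b, a)}, of size 2 since there are no loops. *)
Lemma card_adj (n : nat) (G : sgraph n) :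
  #|[pred p : 'I_n * 'I_n | adj G p.1 p.2]| = (2 * #|edges G|)%N.
Proof.
rewrite -[LHS]sum1_card mulnC -sum_nat_const.
rewrite (partition_big (fun p => [set p.1; p.2]) (mem (edges G)))/=; last first.
  by move=> p Gp; apply/imsetP; exists p; rewrite ?inE.
apply: eq_bigr => e /imsetP[[a b] /= /[!inE]/= ab ->].
have neq_ab : a != b by apply: contraTneq ab => ->; rewrite adj_irr.
have <- : #|[set (a, b); (b, a)]| = 2%N.
  by rewrite cards2 xpair_eqE negb_and neq_ab.
rewrite sum1_card; apply: eq_card => -[c d].
rewrite !inE !xpair_eqE unfold_in inE /=.
apply/andP/orP => [[cd /eqP e_cd]|[/andP[/eqP-> /eqP->]|/andP[/eqP-> /eqP->]]].
- have neq_cd : c != d by apply: contraTneq cd => ->; rewrite adj_irr.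
  have : c \in [set a; b] by rewrite -e_cd set21.
  have : d \in [set a; b] by rewrite -e_cd set22.
  move=> /set2P[] dE /set2P[] cE; subst; rewrite ?eqxx in neq_cd *; by auto.
- by rewrite ab eqxx.
- by rewrite adj_sym ab finset.setUC eqxx.
Qed.

Lemma trmx_adjmx (R : realType) (n : nat) (G : sgraph n) :
  (adjmx R G)^T = adjmx R G.
Proof. by apply/matrixP => i j; rewrite !mxE adj_sym. Qed.

Lemma mxtrace_adjmx (R : realType) (n : nat) (G : sgraph n) :
  \tr (adjmx R G) = 0.
Proof. by apply: big1 => i _; rewrite mxE adj_irr. Qed.

(** The numerator of the Rayleigh quotient at the all-ones vector: it adds up all entries, so it
    counts ordered adjacent pairs. *)
Lemma sum_adjmx (R : realType) (n : nat) (G : sgraph n) :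
  ((const_mx 1 : 'rV[R]_n) *m adjmx R G *m (const_mx 1 : 'rV[R]_n)^T) 0 0 =
  2 * #|edges G|%:R.
Proof.
rewrite -natrM -card_adj -sum1_card natr_sum mxE.
rewrite (eq_bigr (fun j => \sum_(i | adj G i j) 1)) => [|j _]; last first.
  rewrite !mxE mulr1 [RHS]big_mkcond; apply: eq_bigr => i _.
  by rewrite !mxE mul1r; case: adj.
rewrite (exchange_big_dep xpredT)//= pair_big_dep/=.
by apply: eq_bigl => -[i j].
Qed.

Lemma edges_eq0 (n : nat) (G : sgraph n) :
  #|edges G| = 0%N <-> forall i j, adj G i j = false.
Proof.
split=> [/cards0_eq no_edge i j|no_adj].
  apply/negbTE/negP => ij.
  have : [set i; j] \in edges G by apply/imsetP; exists (i, j); rewrite ?inE.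
  by rewrite no_edge inE.
have := card_adj G; rewrite [LHS]eq_card0 => [|[i j]]; last by rewrite inE/=.
by move/esym/eqP; rewrite muln_eq0 => /eqP.
Qed.

Lemma graph_iso_edgeless (n : nat) (G : sgraph n) :
  graph_iso G (edgeless n) <-> #|edges G| = 0%N.
Proof.
rewrite edges_eq0; split=> [[f _ f_adj] i j|no_adj]; first by rewrite -f_adj.
by exists id => [|i j]; [exists id | rewrite no_adj].
Qed.

Lemma spectrum0 (R : realType) (n : nat) (x : R) :
  x \in spectrum (0 : 'M[R]_n) -> x = 0.
Proof.
have [_ char0 _] := @spectrumP R n 0 (trmx0 _ _ _).
rewrite -root_prod_XsubC -char0 -eigenvalue_root_char.
move=> /eigenvalueP[v /esym/eqP]; rewrite mulmx0 scaler_eq0.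
by case/orP => [/eqP|->].
Qed.

(** From e^y = e^x e^(y-x) >= e^x (1 + y - x) one gets e^y - e^x >= e^x (y - x) >= y - x, as e^x >=
    1. *)
Lemma expR_subr_le (R : realType) (x y : R) :
  0 <= x -> x <= y -> expR x - x <= expR y - y.
Proof.
move=> x_ge0 le_xy; rewrite -[in expR y](subrKC x y) expRD.
have le_exp_x := expR_ge1Dx x; have le_exp_yx := expR_ge1Dx (y - x).
nra.
Qed.

Lemma sum_expR_ge (R : realType) (s : seq R) :
  (size s)%:R + \sum_(x <- s) x <= \sum_(x <- s) expR x.
Proof.
rewrite -sum1_size natr_sum -big_split/=.
by apply: ler_sum => x _; exact: expR_ge1Dx.
Qed.

(** Equality of the sums forces 1 + x = e^x term by term, and this inequality is strict away from
    0. *)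
Lemma sum_expR_eq (R : realType) (s : seq R) :
  (size s)%:R + \sum_(x <- s) x = \sum_(x <- s) expR x ->
  forall x, x \in s -> x = 0.
Proof.
elim: s => [//|a s IHs] /=; rewrite !big_cons -natr1 => eq_s.
have ge_a := expR_ge1Dx a; have ge_s := sum_expR_ge s.
have eq_a : 1 + a = expR a by lra.
have eq_s' : (size s)%:R + \sum_(x <- s) x = \sum_(x <- s) expR x by lra.
move=> x /[!inE]/orP[/eqP->|]; last exact: IHs.
by apply/eqP; apply: contra_eqT eq_a => /expR_gt1Dx; rewrite lt_neqAle => /andP[].
Qed.

Theorem theorem1 (R : realType) (n m : nat) (G : sgraph n)
    (n_gt0 : (0 < n)%N) (card_edges : #|edges G| = m) :
  estrada_index R G
    >= expR (2 * m%:R / n%:R) + (n%:R - 1) - 2 * m%:R / n%:R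
  /\ (estrada_index R G
        = expR (2 * m%:R / n%:R) + (n%:R - 1) - 2 * m%:R / n%:R
      <-> graph_iso G (edgeless n)).
Proof.
have A_sym := trmx_adjmx R G.
have [s_sorted _ rayleigh] := spectrumP A_sym.
have := size_spectrum A_sym; have := sum_spectrum A_sym.
rewrite graph_iso_edgeless card_edges /estrada_index mxtrace_adjmx.
have spec0 : m = 0%N -> forall x, x \in spectrum (adjmx R G) -> x = 0.
  move=> m0 x; suff -> : adjmx R G = 0 by exact: spectrum0.
  apply/matrixP => i j; rewrite !mxE.
  by move: card_edges; rewrite m0 => /edges_eq0 ->.
(* The spectrum has n > 0 entries, so it splits into its largest entry [x] and the remaining list
   [s]. *)
move: s_sorted rayleigh spec0; case: (spectrum _) => [|x s] /=.
  by move=> _ _ _ _ n0; move: n_gt0; rewrite -n0.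
move=> x_max rayleigh spec0; rewrite !big_cons => sum0 sz.
set q := 2 * m%:R / n%:R.
have q_ge0 : 0 <= q by rewrite divr_ge0// mulr_ge0.
have q_le_x : q <= x.
  rewrite ler_pdivrMr ?ltr0n// -card_edges -sum_adjmx.
  have -> : n%:R = ((const_mx 1 : 'rV[R]_n) *m (const_mx 1 : 'rV[R]_n)^T) 0 0.
    rewrite mxE (eq_bigr (fun=> 1)) ?sumr_const ?card_ord// => i _.
    by rewrite !mxE mulr1.
  apply: rayleigh => y /[!inE]/orP[/eqP->//|ys].
  have /allP/(_ _ ys)// := order_path_min (rev_trans le_trans) x_max.
have ge_s := sum_expR_ge s.
have nE : n%:R = 1 + (size s)%:R :> R by rewrite -sz nat1r.
have mono := expR_subr_le q_ge0 q_le_x.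
(* By [sum0] the entries of [s] sum to -x, so [ge_s] bounds the index below by e^x - x + (n - 1),
   and [mono] replaces x by q. *)
split; first lra.
split=> [eq_EE|m0].
  (* Equality in the total makes both [ge_s] and [mono] tight. *)
  have eq_s : (size s)%:R + \sum_(y <- s) y = \sum_(y <- s) expR y by lra.
  have sum_s : \sum_(y <- s) y = 0 by apply: big1_seq => y /= /(sum_expR_eq eq_s).
  have : q = 0 by lra.
  move/eqP; rewrite mulf_eq0 invr_eq0 !pnatr_eq0 (gtn_eqF n_gt0) orbF.
  by rewrite mulf_eq0 !pnatr_eq0 => /eqP.
have x0 := spec0 m0 x (mem_head x s).
have exp_s : \sum_(y <- s) expR y = (size s)%:R.
  rewrite -sum1_size natr_sum; apply: eq_big_seq => y ys.
  by rewrite (spec0 m0 y) ?expR0// inE ys orbT.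
by rewrite exp_s nE /q m0 mulr0 mul0r x0 expR0; lra.
Qed.
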